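(* Let $n\ge 2$, let $e_1,\ldots,e_n$ be an orthonormal basis of $\mathbb{R}^n$, and let $p_1,\ldots,p_r$ be points of the unit sphere $\mathbb{S}^{n-1}\subset\mathbb{R}^n$. Then for every integer $k\ge 0$ and every integer $m$ with $0\le m\le n-2$, the $r\times r$ matrix $$\Bigl(G_k^{(n,m)}\bigl(\langle p_i,p_j\rangle,\,p_i^{(m)},\,p_j^{(m)}\bigr)\Bigr)_{i,j=1}^r$$ is positive semidefinite.
   Context: $\langle\cdot,\cdot\rangle$ and $|\cdot|$ denote the Euclidean inner product and norm. For $x\in\mathbb{R}^n$ with coordinates $(x_1,\ldots,x_n)$ in the basis $e_1,\ldots,e_n$, put $x^{(m)}=(x_1,\ldots,x_m)\in\mathbb{R}^m$, and $x^{(0)}=0$. For an integer $n\ge2$, the Gegenbauer polynomials $G_k^{(n)}(t)$ (normalized by $G_k^{(n)}(1)=1$) are given by $G_0^{(n)}=1$, $G_1^{(n)}=t$, and for $k\ge2$ $$G_k^{(n)}=\frac{(2k+n-4)\,t\,G_{k-1}^{(n)}-(k-1)\,G_{k-2}^{(n)}}{k+n-3}.$$ For $0\le m\le n-2$, $t\in\mathbb{R}$, $\mathbf{u},\mathbf{v}\in\mathbb{R}^m$ (with $\mathbf{u}=\mathbf{v}=0$ if $m=0$), the multivariate Gegenbauer polynomial is $$G_k^{(n,m)}(t,\mathbf{u},\mathbf{v}):=(1-|\mathbf{u}|^2)^{k/2}(1-|\mathbf{v}|^2)^{k/2}\,G_k^{(n-m)}\!\left(\frac{t-\langle\mathbf{u},\mathbf{v}\rangle}{\sqrt{(1-|\mathbf{u}|^2)(1-|\mathbf{v}|^2)}}\right),$$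 understood as the polynomial in $2m+1$ variables that this expression defines: if $G_k^{(n-m)}(s)=\sum_j a_j s^{k-2j}$, then $G_k^{(n,m)}(t,\mathbf{u},\mathbf{v})=\sum_j a_j (t-\langle\mathbf{u},\mathbf{v}\rangle)^{k-2j}\bigl((1-|\mathbf{u}|^2)(1-|\mathbf{v}|^2)\bigr)^{j}$. *)

(* Defs.v *)
From HB Require Import structures.
From mathcomp Require Import all_boot all_order all_algebra.
From mathcomp Require Import reals ring zify.
Set Implicit Arguments.
Unset Strict Implicit.
Unset Printing Implicit Defensive.
Import Order.TTheory GRing.Theory Num.Theory.
Local Open Scope ring_scope.

Section Euclidean.
Context {R : realType}.

Definition inner (n : nat) (u v : 'rV[R]_n) : R := \sum_(i < n) u 0 i * v 0 i.

(* The norm `|u| that the analysis library puts on 'rV[R]_n is the sup norm. *)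
Definition enorm (n : nat) (u : 'rV[R]_n) : R := Num.sqrt (inner u u).

Definition orthonormal_basis (n : nat) (e : n.-tuple 'rV[R]_n) : Prop :=
  basis_of fullv e /\ forall i j : 'I_n, inner e`_i e`_j = (i == j)%:R.

(* x^(m): the first m coordinates of x, taken in the basis e rather than in the
   canonical basis of 'rV[R]_n. *)
Definition first_coords (n m : nat) (le_mn : (m <= n)%N)
    (e : n.-tuple 'rV[R]_n) (x : 'rV[R]_n) : 'rV[R]_m :=
  \row_(l < m) coord e (widen_ord le_mn l) x.

Definition posemidef (r : nat) (A : 'M[R]_r) : Prop :=
  A^T = A /\ forall c : 'cV[R]_r, 0 <= (c^T *m A *m c) 0 0.

End Euclidean.

(* The Gegenbauer polynomial G_k^(n), meaningful for 2 <= n; then the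
   denominator k + n - 3 is positive for all k >= 2. *)
Fixpoint gegenbauer (R : realType) (n k : nat) {struct k} : {poly R} :=
  match k with
  | 0 => 1
  | 1 => 'X
  | (k'.+1 as k1).+1 =>
      (k%:R + n%:R - 3)^-1 *:
        ((2 * k%:R + n%:R - 4) *: ('X * gegenbauer R n k1)
         - (k%:R - 1) *: gegenbauer R n k')
  end.

(* G_k^(n,m)(t, u, v), as the value of the polynomial
   \sum_j a_j (t - <u,v>)^(k - 2j) ((1 - |u|^2) (1 - |v|^2))^j, where a_j is
   the coefficient of s^(k - 2j) in G_k^(n-m)(s). *)
Definition mgegenbauer (R : realType) (n m k : nat) (t : R) (u v : 'rV[R]_m) : R :=
  \sum_(j < k./2.+1)
    (gegenbauer R (n - m) k)`_(k - j.*2) * (t - inner u v) ^+ (k - j.*2)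
    * ((1 - enorm u ^+ 2) * (1 - enorm v ^+ 2)) ^+ j.

Section Checks.
Context {R : realType}.

Lemma gegenbauerSS n k : gegenbauer R n k.+2 =
  (k.+2%:R + n%:R - 3)^-1 *:
    ((2 * k.+2%:R + n%:R - 4) *: ('X * gegenbauer R n k.+1)
     - (k.+2%:R - 1) *: gegenbauer R n k).
Proof. by []. Qed.

Lemma gegenbauer1 n k : (2 <= n)%N -> (gegenbauer R n k).[1] = 1.
Proof.
move=> n2; elim/ltn_ind: k => -[|[|k]] IH; rewrite ?hornerC ?hornerX //.
rewrite gegenbauerSS hornerZ hornerD hornerN !hornerZ hornerM hornerX.
rewrite !IH // !mulr1.
have -> : 2 * k.+2%:R + n%:R - 4 - (k.+2%:R - 1) = k.+2%:R + n%:R - 3 :> R.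
  by ring.
rewrite mulVf // -natrD subr_eq0 eqr_nat; lia.
Qed.

Lemma gegenbauer_parity n k i : odd i != odd k -> (gegenbauer R n k)`_i = 0.
Proof.
elim/ltn_ind: k i => -[|[|k]] IH i par.
- by rewrite coef1; case: i par.
- by rewrite coefX; case: i par => [|[|i]].
rewrite gegenbauerSS coefZ coefB !coefZ coefXM.
have -> : (gegenbauer R n k)`_i = 0 by apply: IH => //; lia.
case: eqP => [_|i0]; first by rewrite !mulr0 subr0 mulr0.
rewrite IH //; last by lia.
by rewrite !mulr0 subr0 mulr0.
Qed.

Lemma size_gegenbauer n k : (size (gegenbauer R n k) <= k.+1)%N.
Proof.
elim/ltn_ind: k => -[|[|k]] IH; rewrite ?size_poly1 ?size_polyX //.
rewrite gegenbauerSS (leq_trans (size_scale_leq _ _)) //.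
rewrite (leq_trans (size_polyD _ _)) // geq_max size_polyN.
apply/andP; split; apply: leq_trans (size_scale_leq _ _) _; last first.
  by rewrite (leq_trans (IH _ _)) // !ltnS -addn2 leq_addr.
rewrite (leq_trans (size_polyMleq _ _)) // size_polyX add2n /= ltnS.
exact: IH.
Qed.

Lemma sum_parity (F : nat -> R) k :
  (forall i, odd i != odd k -> F i = 0) ->
  \sum_(i < k.+1) F i = \sum_(j < k./2.+1) F (k - j.*2)%N.
Proof.
elim/ltn_ind: k => -[|[|k]] IH par; first by rewrite !big_ord1.
  by rewrite big_ord_recr !big_ord1 /= par ?add0r.
rewrite 2!big_ord_recr /= [F k.+1]par ?addr0; last by rewrite /= negbK; case: odd.
rewrite IH //; last by move=> i pi; apply: par; rewrite /= negbK.
by rewrite [RHS]big_ord_recl subn0 addrC; congr (_ + _).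
Qed.

(* On the open unit ball the polynomial is the original expression with
   square roots; here (1 - |u|^2)^(k/2) is written sqrt(1 - |u|^2)^k. *)
Lemma mgegenbauerE n m k (t : R) (u v : 'rV[R]_m) :
  enorm u < 1 -> enorm v < 1 ->
  mgegenbauer n k t u v =
    Num.sqrt (1 - enorm u ^+ 2) ^+ k * Num.sqrt (1 - enorm v ^+ 2) ^+ k
    * (gegenbauer R (n - m) k).[(t - inner u v) /
         Num.sqrt ((1 - enorm u ^+ 2) * (1 - enorm v ^+ 2))].
Proof.
move=> u1 v1.
have pos w : enorm w < 1 -> 0 < 1 - @enorm R m w ^+ 2.
  by move=> w1; rewrite subr_gt0 expr_lt1 ?sqrtr_ge0.
have a0 := pos _ u1; have b0 := pos _ v1.
rewrite /mgegenbauer; set a := 1 - _ in a0 *; set b := 1 - _ in b0 *.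
rewrite -exprMn -sqrtrM ?ltW //.
have c0 : 0 < a * b by rewrite mulr_gt0.
move: (a * b) c0 => {a b a0 b0} c c0.
have s0 : Num.sqrt c != 0 by rewrite lt0r_neq0 // sqrtr_gt0.
rewrite (horner_coef_wide _ (size_gegenbauer _ _)) mulr_sumr.
set s := _ / _; pose F i := Num.sqrt c ^+ k * ((gegenbauer R (n - m) k)`_i * s ^+ i).
rewrite [RHS](_ : _ = \sum_(i < k.+1) F i) // (sum_parity (F := F)); last first.
  by move=> i /gegenbauer_parity; rewrite /F => ->; rewrite mul0r mulr0.
apply: eq_bigr => j _; rewrite /F /s mulrCA -mulrA; congr (_ * _).
have le_jk : (j.*2 <= k)%N.
  by rewrite -[leqRHS]odd_double_half (leq_trans _ (leq_addl _ _)) // leq_double -ltnS.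
rewrite -[in Num.sqrt c ^+ k](subnK le_jk) exprD expr_div_n.
have -> : Num.sqrt c ^+ j.*2 = c ^+ j.
  by rewrite -mul2n exprM sqr_sqrtr ?ltW//.
by field; rewrite expf_neq0.
Qed.

End Checks.

(* Main.v *)
From HB Require Import structures.
Require Import Defs.
From mathcomp Require Import all_boot all_order all_algebra.
From mathcomp Require Import reals ring zify.
From mathcomp Require Import mpoly.

(** Write x' for the last N = n - m coordinates of a point x of the unit sphere
    in the basis e.  Since <x, y> - <x^(m), y^(m)> = <x', y'> and
    1 - |x^(m)|^2 = |x'|^2, the (i, j) entry of the matrix is
      H_k(x, y) = \sum_j a_j <x, y>^(k - 2j) (|x|^2 |y|^2)^j
    taken at p_i' and p_j', where the a_j are the coefficients of G_k^(N).  So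
    it has to be shown that H_k is a positive semidefinite kernel on R^N; this
    is Schoenberg's theorem, extended from the sphere to the whole space by
    homogeneity.

    For a fixed y, H_k(., y) is a k-homogeneous polynomial in N variables,
    called [zonal y k] below, and it is harmonic.  Harmonicity comes from the
    three-term recursion, by induction: the Laplacian of <., y> H_{k-1}(., y)
    is twice the derivative of H_{k-1}(., y) in the direction y, and the
    recursion also yields that derivative,
      D_y H_k(., y) = k |y|^2 H_{k-1}(., y)          ([dirderiv_zonal]);
    what remains cancels ([zonal_harmonic]).

    Polynomials carry the Fischer product <f, g> = f(d/dX) g at 0, which is
    positive and for which multiplication by X_i is adjoint to d/dX_i.  Thus:
    - multiplication by |X|^2 is adjoint to the Laplacian, so multiples of
      |X|^2 are orthogonal to harmonic polynomials.  Modulo |X|^2 the recursion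
      says that H_k(., x) is A <., x>^k for a constant A > 0, hence
      <H_k(., x), g> = A <<., x>^k, g> for g harmonic ([fischer_zonal]);
    - <., x>^k represents evaluation at x: <<., x>^k, g> = k! g(x) for g
      homogeneous of degree k ([fischer_linform_exp]).
    With g = H_k(., y) this gives <H_k(., x), H_k(., y)> = A k! H_k(x, y): up to
    a positive factor the kernel is a Gram matrix ([zonal_posdef]). *)

Set Implicit Arguments.
Unset Strict Implicit.
Unset Printing Implicit Defensive.
Import Order.TTheory GRing.Theory Num.Theory.
Local Open Scope ring_scope.

(** * The Fischer product *)

Section Fischer.
Context {R : comNzRingType} {N : nat}.
Implicit Types (d : nat) (f g : {mpoly R[N]}).

Definition mfact (a : 'X_{1..N}) : nat := \prod_(i < N) (a i)`!.

(** In monomial coordinates f(d/dX) g at 0 is the sum of a! f_a g_a.  The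
    truncation to degrees below d makes the sum range over a fixed finite type,
    so that bilinearity is immediate; multiplication by a form of degree j then
    shifts d by j in the adjunctions below. *)
Definition fischer d f g : R :=
  \sum_(a : 'X_{1..N < d}) (mfact a)%:R * f@_a * g@_a.

Lemma fischerC d f g : fischer d f g = fischer d g f.
Proof. by apply: eq_bigr => a _; rewrite mulrAC. Qed.

Lemma fischer_scalar d f : scalar (fischer d f).
Proof.
move=> c g h; rewrite /fischer mulr_sumr -big_split; apply: eq_bigr => a _ /=.
by rewrite mcoeffD mcoeffZ; ring.
Qed.

HB.instance Definition _ d f :=
  GRing.isLinear.Build R {mpoly R[N]} R *%R (fischer d f) (fischer_scalar d f).

Lemma mfactD1 (a : 'X_{1..N}) (i : 'I_N) :
  mfact (U_(i) + a) = ((a i).+1 * mfact a)%N.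
Proof.
rewrite /mfact (bigD1 i) //= [in RHS](bigD1 i) //= mnmDE mnm1E eqxx add1n factS.
rewrite -mulnA; congr (_ * (_ * _))%N; apply: eq_bigr => j ji.
by rewrite mnmDE mnm1E eq_sym (negbTE ji).
Qed.

Fact bmnmS_subproof d (i : 'I_N) (a : 'X_{1..N < d}) :
  (mdeg (U_(i) + a)%MM < d.+1)%N.
Proof. by rewrite mdegD mdeg1 add1n ltnS bmdeg. Qed.

(** The factor a! is chosen for this adjunction: (U_i + a)! = (a_i + 1) a!, and
    a_i + 1 is the factor that differentiation produces. *)
Lemma fischerXl d (i : 'I_N) f g :
  fischer d.+1 ('X_i * f) g = fischer d f g^`M(i).
Proof.
rewrite /fischer (bigID (fun a : 'X_{1..N < d.+1} => a i == 0%N)) /=.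
rewrite big1 ?add0r; last first.
  move=> a /eqP ai0; rewrite (memN_msupp_eq0 (m := a)) ?mulr0 ?mul0r //.
  rewrite mulrC (perm_mem (msuppMX f U_(i))).
  by apply/mapP => -[b _ aE]; move: ai0; rewrite aE mnmDE mnm1E eqxx.
rewrite (reindex_omap (fun a => BMultinom (bmnmS_subproof i a))
                      (fun b => insub (b - U_(i))%MM)) /=; last first.
  move=> b bi; have bE : (U_(i) + (b - U_(i)) = b)%MM.
    by rewrite addmC submK // lep1mP.
  have bd : (mdeg (b - U_(i))%MM < d)%N.
    by move: (bmdeg b); rewrite -[X in mdeg X]bE mdegD mdeg1.
  by rewrite (insubT (fun b => mdeg b < d)%N bd) /=; congr Some; apply: val_inj.
apply: eq_big => [a|a _].
  rewrite mnmDE mnm1E eqxx add1n /= [(U_(i) + _)%MM]addmC addmK.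
  rewrite (insubT (fun b => mdeg b < d)%N (bmdeg a)).
  by apply/eqP; congr Some; apply: val_inj.
rewrite mfactD1 ['X_i * f]mulrC mcoeffMX mcoeff_mderiv [(_ + U_(i))%MM]addmC natrM.
by rewrite -[g@__ *+ _]mulr_natl; ring.
Qed.

End Fischer.

Lemma fischer_ge0 (R : realDomainType) (N d : nat) (f : {mpoly R[N]}) :
  0 <= fischer d f f.
Proof.
apply: sumr_ge0 => a _; rewrite -mulrA mulr_ge0 ?ler0n //.
by rewrite -expr2 sqr_ge0.
Qed.

(** * Linear forms, the squared norm and their adjoint operators *)

Section Operators.
Context {R : comNzRingType} {N : nat}.
Implicit Types (x y : 'rV[R]_N) (f g : {mpoly R[N]}).

Definition linform x : {mpoly R[N]} := \sum_(i < N) x 0 i *: 'X_i.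

Definition normform : {mpoly R[N]} := \sum_(i < N) 'X_i ^+ 2.

Definition dirderiv x f : {mpoly R[N]} := \sum_(i < N) x 0 i *: f^`M(i).

Definition laplacian f : {mpoly R[N]} := \sum_(i < N) f^`M(i)^`M(i).

Definition euler f : {mpoly R[N]} := \sum_(i < N) 'X_i * f^`M(i).

Lemma mderivXU (i j : 'I_N) : ('X_j : {mpoly R[N]})^`M(i) = (i == j)%:R.
Proof.
rewrite mderivX mnm1E eq_sym; case: eqVneq => [->|_]; last by rewrite scale0r.
by rewrite -[X in (X - _)%MM]add0m addmK mpolyX0 scale1r.
Qed.

Lemma mderiv_linform x i : (linform x)^`M(i) = (x 0 i)%:MP.
Proof.
rewrite /linform raddf_sum (bigD1 i) //= mderivZ mderivXU eqxx big1 ?addr0.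
  by rewrite alg_mpolyC.
by move=> j ji; rewrite mderivZ mderivXU eq_sym (negbTE ji) scaler0.
Qed.

Lemma mderiv_normform i : normform^`M(i) = 'X_i *+ 2 :> {mpoly R[N]}.
Proof.
rewrite /normform raddf_sum (bigD1 i) //= expr2 mderivM mderivXU eqxx big1.
  by rewrite addr0 mul1r mulr1 mulr2n.
by move=> j ji; rewrite expr2 mderivM mderivXU eq_sym (negbTE ji) mul0r mulr0 addr0.
Qed.

Lemma dirderiv_linear x : linear (dirderiv x).
Proof.
move=> c f g; rewrite /dirderiv scaler_sumr -big_split; apply: eq_bigr => i _ /=.
by rewrite mderivD mderivZ scalerDr !scalerA mulrC.
Qed.

HB.instance Definition _ x :=
  GRing.isLinear.Build R _ _ _ (dirderiv x) (dirderiv_linear x).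

Lemma dirderivM x f g :
  dirderiv x (f * g) = dirderiv x f * g + f * dirderiv x g.
Proof.
rewrite /dirderiv mulr_suml mulr_sumr -big_split; apply: eq_bigr => i _ /=.
by rewrite mderivM scalerDr scalerAl scalerAr.
Qed.

Lemma dirderivC x c : dirderiv x c%:MP = 0.
Proof. by rewrite /dirderiv big1 // => i _; rewrite mderivC scaler0. Qed.

Lemma dirderiv_linform x y :
  dirderiv x (linform y) = (\sum_(i < N) x 0 i * y 0 i)%:MP.
Proof.
rewrite /dirderiv raddf_sum; apply: eq_bigr => i _ /=.
by rewrite mderiv_linform mpolyCM mul_mpolyC.
Qed.

Lemma dirderiv_normform x : dirderiv x normform = linform x *+ 2.
Proof.
rewrite /dirderiv /linform -sumrMnl; apply: eq_bigr => i _.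
by rewrite mderiv_normform scalerMnr.
Qed.

Lemma laplacian_linear : linear laplacian.
Proof.
move=> c f g; rewrite /laplacian scaler_sumr -big_split; apply: eq_bigr => i _ /=.
by rewrite !(mderivD, mderivZ).
Qed.

HB.instance Definition _ :=
  GRing.isLinear.Build R _ _ _ laplacian laplacian_linear.

Lemma mderiv_dirderiv i x f : (dirderiv x f)^`M(i) = dirderiv x f^`M(i).
Proof.
rewrite (linear_sum (mderiv i)); apply: eq_bigr => j _ /=.
by rewrite mderivZ mderiv_comm.
Qed.

Lemma laplacian_dirderiv x f : laplacian (dirderiv x f) = dirderiv x (laplacian f).
Proof.
rewrite [RHS]linear_sum; apply: eq_bigr => i _ /=.
by rewrite !mderiv_dirderiv.
Qed.

Lemma laplacianM f g : laplacian (f * g) =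
  laplacian f * g + (\sum_(i < N) f^`M(i) * g^`M(i)) *+ 2 + f * laplacian g.
Proof.
rewrite /laplacian mulr_suml mulr_sumr -sumrMnl -!big_split.
by apply: eq_bigr => i _ /=; rewrite !(mderivM, mderivD); ring.
Qed.

Lemma laplacianM_linform y f :
  laplacian (linform y * f) = dirderiv y f *+ 2 + linform y * laplacian f.
Proof.
rewrite laplacianM; congr (_ + _); rewrite /laplacian big1 ?mul0r ?add0r.
  congr (_ *+ 2); apply: eq_bigr => i _.
  by rewrite mderiv_linform mul_mpolyC.
by move=> i _; rewrite mderiv_linform mderivC.
Qed.

Lemma laplacianM_normform f : laplacian (normform * f) =
  f *+ (2 * N) + euler f *+ 4 + normform * laplacian f.
Proof.
rewrite laplacianM; congr (_ + _ + _).
  rewrite -mulr_natl; congr (_ * _); rewrite /laplacian (eq_bigr (fun=> 2%:R)).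
    by rewrite sumr_const card_ord natrM mulr_natr.
  by move=> i _; rewrite mderiv_normform mderivMn mderivXU eqxx.
rewrite -[4%N]/(2 * 2)%N mulrnA; congr (_ *+ 2); rewrite /euler -sumrMnl.
by apply: eq_bigr => i _; rewrite mderiv_normform mulrnAl.
Qed.

Lemma euler_linear : linear euler.
Proof.
move=> c f g; rewrite /euler scaler_sumr -big_split; apply: eq_bigr => i _ /=.
by rewrite mderivD mderivZ mulrDr scalerAr.
Qed.

HB.instance Definition _ :=
  GRing.isLinear.Build R _ _ _ euler euler_linear.

(** Fischer duality turns a polynomial into the differential operator with the
    same symbol: here a linear form, and next the squared norm. *)
Lemma fischerMl_linform d x f g :
  fischer d.+1 (linform x * f) g = fischer d f (dirderiv x g).
Proof.
rewrite fischerC /linform /dirderiv mulr_suml !linear_sum; apply: eq_bigr => i _.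
by rewrite -scalerAl !linearZ /= -fischerXl fischerC.
Qed.

Lemma fischerMl_normform d f g :
  fischer d.+2 (normform * f) g = fischer d f (laplacian g).
Proof.
rewrite fischerC /normform /laplacian mulr_suml !linear_sum.
by apply: eq_bigr => i _ /=; rewrite expr2 -mulrA fischerC !fischerXl.
Qed.

End Operators.

(** * Homogeneous polynomials *)

Section Homogeneous.
Context {R : comNzRingType} {N : nat}.
Implicit Types (x y : 'rV[R]_N) (f g : {mpoly R[N]}).

Lemma linform_homog x : linform x \is 1.-homog.
Proof. by apply: rpred_sum => i _; rewrite rpredZ // dhomogX /= mdeg1. Qed.

Lemma normform_homog : normform \is [in R[N], 2.-homog].
Proof.
apply: rpred_sum => i _; rewrite -[2%N]/(1 * 2)%N dhomogMn //.
by rewrite dhomogX /= mdeg1.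
Qed.

Lemma dirderiv_homog x k f : f \is k.+1.-homog -> dirderiv x f \is k.-homog.
Proof.
move=> /dhomogP fh; apply: rpred_sum => i _; rewrite rpredZ //.
apply/dhomogP => m; rewrite mcoeff_msupp mcoeff_mderiv => fm.
have /fh : (m + U_(i))%MM \in msupp f.
  by rewrite mcoeff_msupp; apply: contraNneq fm => ->; rewrite mul0rn.
by rewrite /= mdegD mdeg1 addn1 => -[].
Qed.

Lemma eulerX m : euler 'X_[m] = 'X_[m] *+ mdeg m :> {mpoly R[N]}.
Proof.
rewrite mdegE -sumrMnr; apply: eq_bigr => i _; rewrite mderivX -scalerAr scaler_nat.
have [->|mi] := eqVneq (m i) 0%N; first by rewrite !mulr0n.
by rewrite -mpolyXD addmC submK // lep1mP.
Qed.

Lemma euler_homog k f : f \is k.-homog -> euler f = f *+ k.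
Proof.
move=> /dhomogP fh; rewrite [in LHS](mpolyE f) linear_sum /= [in RHS](mpolyE f).
rewrite -sumrMnl big_seq [RHS]big_seq; apply: eq_bigr => m mf.
by rewrite linearZ /= eulerX (fh m mf) scalerMnr.
Qed.

(** The Euler operator differentiates at each point in the direction of that
    point; on forms this reduces a derivative along x to a value at x. *)
Lemma meval_dirderiv x f : (dirderiv x f).@[x 0] = (euler f).@[x 0].
Proof.
rewrite !raddf_sum; apply: eq_bigr => i _ /=.
by rewrite mevalZ mevalM mevalXU.
Qed.

(** Moving the k linear factors to the other side differentiates f k times in
    the direction x; by Euler's identity each derivative of a form of degree j
    contributes a factor j to the value at x.  The bound k + 1 on the Fischer
    product is the least one that keeps the terms of degree k. *)
Lemma fischer_linform_exp x k f : f \is k.-homog ->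
  fischer k.+1 (linform x ^+ k) f = k`!%:R * f.@[x 0].
Proof.
elim: k f => [|k IH] f fh.
  rewrite expr0 mul1r.
  have [c ->] : exists c, f = c%:MP.
    exists f@_0; apply/mpolyP => m; rewrite mcoeffC.
    have [->|m0] := eqVneq m 0%MM; first by rewrite mulr1.
    by rewrite mulr0 (dhomog_nemf_coeff fh) // mdeg_eq0.
  rewrite mevalC /fischer (bigD1 bm0) //= big1 ?addr0 => [|a].
    by rewrite !mcoeffC eqxx /mfact big1 ?mulr1 ?mul1r // => i _; rewrite mnm0E.
  move=> a0; have := bmdeg a.
  by rewrite ltnS leqn0 mdeg_eq0 -[_ == _]/(a == bm0) (negbTE a0).
rewrite exprS fischerMl_linform IH ?dirderiv_homog // meval_dirderiv.
by rewrite (euler_homog fh) mevalMn factS natrM -mulr_natl; ring.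
Qed.

End Homogeneous.

(** * Zonal harmonics *)

Lemma lmod_mulrnI (F : numFieldType) (V : lmodType F) (c : nat) (u v : V) :
  (0 < c)%N -> u *+ c = v *+ c -> u = v.
Proof.
move=> c0; rewrite -!scaler_nat => /(scalerI _); apply.
by rewrite pnatr_eq0 -lt0n.
Qed.

Section Zonal.
Context {R : realType} {N : nat}.
Context (N_ge2 : (2 <= N)%N).
Implicit Types (x y : 'rV[R]_N) (f g : {mpoly R[N]}).

(** The homogenization of the Gegenbauer polynomial in the variable point, with
    the pole y: <X, y> stands for t, and |X|^2 |y|^2 for 1.  It is computed by
    the recursion rather than from the coefficients because everything proved
    about it goes by induction along the recursion. *)
Fixpoint zonal y (k : nat) : {mpoly R[N]} :=
  match k with
  | 0 => 1
  | 1 => linform y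
  | (k'.+1 as k1).+1 =>
      (k%:R + N%:R - 3)^-1 *:
        ((2 * k%:R + N%:R - 4) *: (linform y * zonal y k1)
         - (k%:R - 1) *: (inner y y *: (normform * zonal y k')))
  end.

(** The recursion with its denominator cleared; for N >= 2 it is the positive
    number k + N - 1.  Natural multiples commute with every additive operator,
    and they are the same over R and over the polynomials. *)
Lemma zonalSS y k :
  zonal y k.+2 *+ (k + N).-1 =
    (linform y * zonal y k.+1) *+ (k.*2 + N)
    - (inner y y *: (normform * zonal y k)) *+ k.+1.
Proof.
have Nk : (k + N).-1%:R = k%:R + N%:R - 1 :> R.
  by rewrite -subn1 natrB ?natrD //; lia.
have kE : (k.*2 + N)%:R = 2 * k.+2%:R + N%:R - 4 :> R.
  by rewrite natrD -mul2n natrM; ring.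
have c0 : k.+2%:R + N%:R - 3 != 0 :> R.
  have -> : k.+2%:R + N%:R - 3 = (k + N).-1%:R :> R by rewrite Nk; ring.
  by rewrite pnatr_eq0; lia.
rewrite -!scaler_nat Nk kE [zonal y k.+2]/=.
have -> : k%:R + N%:R - 1 = k.+2%:R + N%:R - 3 :> R by ring.
by rewrite [LHS]scalerA mulfV // scale1r; congr (_ - _ *: _); ring.
Qed.

Lemma zonal_homog y k : zonal y k \is k.-homog.
Proof.
elim/ltn_ind: k => -[|[|k]] IH; first exact: dhomog1.
  exact: linform_homog.
rewrite /= rpredZ // rpredB // rpredZ //.
  exact: (dhomogM (linform_homog y) (IH k.+1 (leqnn _))).
by rewrite rpredZ //; exact: (dhomogM normform_homog (IH k (leqnSn _))).
Qed.

Arguments zonal : simpl never.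

(** Differentiating the recursion for z_{k+2} brings in z_{k-1} through the
    derivative of z_k; the recursion for z_{k+1} eliminates it, and the
    coefficients of <X, y> z_k then cancel. *)
Lemma dirderiv_zonal y k :
  dirderiv y (zonal y k.+1) = (inner y y *: zonal y k) *+ k.+1.
Proof.
elim/ltn_ind: k => -[_|k IH].
  by rewrite dirderiv_linform -alg_mpolyC.
(* At k = 0 the factor z_{k-1} stands for nothing, and is multiplied by 0. *)
have prev : zonal y k.+1 * (k%:R + N%:R - 2) =
    linform y * zonal y k * (2 * k%:R + N%:R - 2)
    - (inner y y)%:MP * (normform * zonal y k.-1) * k%:R.
  case: k {IH} => [|k]; first by rewrite /zonal /=; ring.
  rewrite succnK.
  have := zonalSS y k; rewrite -mul_mpolyC -[LHS]mulr_natr => H.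
  have -> : k.+1%:R + N%:R - 2 = (k + N).-1%:R :> {mpoly R[N]}.
    by rewrite -subn1 natrB ?natrD; [ring | lia].
  by rewrite H -mul2n; ring.
have IHk : dirderiv y (zonal y k) = (inner y y *: zonal y k.-1) *+ k.
  case: k {prev} IH => [|k] IH; last exact: IH.
  by rewrite mulr0n dirderivC.
apply: (@lmod_mulrnI _ _ (k + N).-1); first by lia.
rewrite -linearMn zonalSS linearB !linearMn linearZ /= !dirderivM.
rewrite dirderiv_linform dirderiv_normform IH // IHk.
rewrite -!mul_mpolyC -[RHS]mulr_natr.
rewrite -[\sum_(i < N) _]/(inner y y) -mul2n.
have -> : (k + N).-1%:R = k%:R + N%:R - 1 :> {mpoly R[N]}.
  by rewrite -subn1 natrB ?natrD //; lia.
move: prev; set z2 := zonal y k.+1; set z1 := zonal y k; set z0 := zonal y k.-1.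
set rho := (inner y y)%:MP => prev.
have -> : normform * (rho * z0 *+ k) =
    linform y * z1 * (2 * k%:R + N%:R - 2) - z2 * (k%:R + N%:R - 2).
  by rewrite prev; ring.
by ring.
Qed.

(** The term <X, y> z_{k+1} contributes twice the derivative of z_{k+1} along y,
    that is 2 (k + 1) |y|^2 z_k, and |X|^2 z_k contributes (2 N + 4 k) z_k by
    Euler's identity; weighted as in the recursion, they cancel. *)
Lemma zonal_harmonic y k : laplacian (zonal y k) = 0.
Proof.
elim/ltn_ind: k => -[|[|k]] IH.
- by rewrite /laplacian big1 // => i _; rewrite !mderivC.
- by rewrite /laplacian big1 // => i _; rewrite mderiv_linform mderivC.
apply: (@lmod_mulrnI _ _ (k + N).-1); first by lia.
rewrite -linearMn zonalSS linearB !linearMn linearZ /=.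
rewrite laplacianM_linform laplacianM_normform !IH // dirderiv_zonal.
rewrite (euler_homog (zonal_homog y k)) -!mul_mpolyC -mul2n; ring.
Qed.

(** Against a harmonic g only the term of the recursion without |X|^2 counts.
    The induction needs all harmonic g, since the linear factor moves to the
    other side as a derivative of g, which is again harmonic. *)
Lemma fischer_zonal k : exists2 A : R, 0 < A & forall x g, laplacian g = 0 ->
  fischer k.+1 (zonal x k) g = A * fischer k.+1 (linform x ^+ k) g.
Proof.
elim: k => [|[|k] IH].
- by exists 1 => // x g _; rewrite mul1r.
- by exists 1 => // x g _; rewrite mul1r.
have [A A0 AE] := IH; pose c := (k + N).-1%:R : R.
have c0 : 0 < c by rewrite ltr0n; lia.
exists ((k.*2 + N)%:R * A / c) => [|x g gh].
  by rewrite divr_gt0 // mulr_gt0 // ltr0n; lia.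
apply: (mulfI (lt0r_neq0 c0)).
rewrite [LHS]mulr_natl fischerC -linearMn zonalSS linearB !linearMn linearZ /=.
rewrite ![fischer _ g _]fischerC fischerMl_normform gh linear0.
rewrite fischerMl_linform AE; last by rewrite laplacian_dirderiv gh linear0.
rewrite -fischerMl_linform -exprS mulr0 mul0rn subr0 -mulr_natr.
by field; rewrite lt0r_neq0.
Qed.

(** The double sum is, up to the factor A k!, the Fischer square of the
    combination of zonal harmonics with coefficients c. *)
Lemma zonal_posdef k r (x : 'I_r -> 'rV[R]_N) (c : 'I_r -> R) :
  0 <= \sum_(i < r) \sum_(j < r) c i * c j * (zonal (x j) k).@[x i 0].
Proof.
have [A A0 AE] := fischer_zonal k.
have B0 : 0 < A * k`!%:R by rewrite mulr_gt0 // ltr0n fact_gt0.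
rewrite -(pmulr_rge0 _ B0).
pose f := \sum_(i < r) c i *: zonal (x i) k.
suff <- : fischer k.+1 f f = A * k`!%:R *
    \sum_(i < r) \sum_(j < r) c i * c j * (zonal (x j) k).@[x i 0].
  exact: fischer_ge0.
rewrite {2}/f linear_sum mulr_sumr; apply: eq_bigr => i _.
rewrite linearZ /= fischerC /f linear_sum !mulr_sumr; apply: eq_bigr => j _.
rewrite linearZ /= AE ?zonal_harmonic // fischer_linform_exp ?zonal_homog //.
by ring.
Qed.

End Zonal.

(** * Values of zonal harmonics *)

Section HomogenizedGegenbauer.
Context {R : realType}.
Implicit Types (n k : nat) (s c : R).

(** The multivariate Gegenbauer polynomial as a function of s = t - <u, v> and
    c = (1 - |u|^2) (1 - |v|^2), the only data on which it depends. *)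
Definition hgegenbauer n k s c : R :=
  \sum_(j < k./2.+1) (gegenbauer R n k)`_(k - j.*2) * s ^+ (k - j.*2) * c ^+ j.

(** By parity the sum may run over all the coefficients, which suits the
    recursion better: multiplication by X is then a plain shift of the index. *)
Lemma hgegenbauerE n k s c : hgegenbauer n k s c =
  \sum_(i < k.+1) (gegenbauer R n k)`_i * (s ^+ i * c ^+ (k - i)./2).
Proof.
pose F i := (gegenbauer R n k)`_i * (s ^+ i * c ^+ (k - i)./2).
rewrite (@sum_parity _ F).
  apply: eq_bigr => -[j /= jk] _; rewrite -mulrA; congr (_ * (_ * _ ^+ _)); lia.
by move=> i /gegenbauer_parity; rewrite /F => ->; rewrite mul0r.
Qed.

Lemma hgegenbauerSS n k s c : hgegenbauer n k.+2 s c =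
  (k.+2%:R + n%:R - 3)^-1 *
    ((2 * k.+2%:R + n%:R - 4) * (s * hgegenbauer n k.+1 s c)
     - (k.+2%:R - 1) * (c * hgegenbauer n k s c)).
Proof.
have s1 : \sum_(i < k.+3)
    ('X * gegenbauer R n k.+1)`_i * (s ^+ i * c ^+ (k.+2 - i)./2) =
    s * hgegenbauer n k.+1 s c.
  rewrite hgegenbauerE big_ord_recl coefXM eqxx mul0r add0r mulr_sumr.
  by apply: eq_bigr => i _; rewrite coefXM /= /bump add1n subSS exprS; ring.
have s2 : \sum_(i < k.+3)
    (gegenbauer R n k)`_i * (s ^+ i * c ^+ (k.+2 - i)./2) =
    c * hgegenbauer n k s c.
  rewrite hgegenbauerE 2!big_ord_recr /= [_`_k.+2]nth_default ?[_`_k.+1]nth_default.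
  - rewrite !mul0r !addr0 mulr_sumr; apply: eq_bigr => i _.
    have -> : ((k.+2 - i)./2 = ((k - i)./2).+1)%N by have := ltn_ord i; lia.
    by rewrite exprS; ring.
  - exact: size_gegenbauer.
  - by rewrite (leq_trans (size_gegenbauer _ _)).
rewrite -s1 -s2 hgegenbauerE mulrBr !mulr_sumr -sumrB; apply: eq_bigr => i _.
by rewrite gegenbauerSS coefZ coefB !coefZ; ring.
Qed.

(** Both sides satisfy the same three-term recursion, since evaluation at x
    sends <X, y> to <x, y> and |X|^2 |y|^2 to |x|^2 |y|^2. *)
Lemma meval_zonal n k (x y : 'rV[R]_n) :
  (zonal y k).@[x 0] = hgegenbauer n k (inner x y) (inner x x * inner y y).
Proof.
have linE : (linform y).@[x 0] = inner x y.
  rewrite raddf_sum; apply: eq_bigr => i _ /=.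
  by rewrite mevalZ mevalXU mulrC.
have normE : normform.@[x 0] = inner x x.
  by rewrite raddf_sum; apply: eq_bigr => i _ /=; rewrite rmorphXn /= mevalXU.
elim/ltn_ind: k => -[|[|k]] IH.
- by rewrite meval1 /hgegenbauer big_ord1 coef1 !expr0 !mulr1.
- by rewrite linE /hgegenbauer big_ord1 coefX expr1 expr0 mulr1 mul1r.
rewrite hgegenbauerSS -!IH // mevalZ mevalB !mevalZ !mevalM linE normE.
by ring.
Qed.

End HomogenizedGegenbauer.

(** * Reduction to the last coordinates *)

Lemma innerC (R : realType) n (u v : 'rV[R]_n) : inner u v = inner v u.
Proof. by apply: eq_bigr => i _; rewrite mulrC. Qed.

Section Coordinates.
Context {R : realType} {n : nat} {e : n.-tuple 'rV[R]_n}.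
Context (he : orthonormal_basis e).

Lemma inner_coord (x y : 'rV[R]_n) :
  inner x y = \sum_(i < n) coord e i x * coord e i y.
Proof.
have [be ortho] := he.
have innerDl : forall (I : finType) (a : I -> R) (u : I -> 'rV[R]_n) v,
   inner (\sum_i a i *: u i) v = \sum_i a i * inner (u i) v.
  move=> I a u v; rewrite /inner; under eq_bigr do rewrite summxE mulr_suml.
  rewrite exchange_big; apply: eq_bigr => i _; rewrite mulr_sumr.
  by apply: eq_bigr => l _; rewrite mxE mulrA.
rewrite {1}(coord_basis be (memvf x)) innerDl; apply: eq_bigr => i _.
congr (_ * _); rewrite {1}(coord_basis be (memvf y)) innerC innerDl.
rewrite (bigD1 i) //= ortho eqxx mulr1 big1 ?addr0 // => j ji.
by rewrite ortho (negbTE ji) mulr0.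
Qed.

End Coordinates.

Lemma enorm_sqr (R : realType) n (u : 'rV[R]_n) : enorm u ^+ 2 = inner u u.
Proof. by rewrite sqr_sqrtr // sumr_ge0 // => i _; rewrite -expr2 sqr_ge0. Qed.

Theorem theorem3p1 (R : realType) (n : nat) (hn : (2 <= n)%N)
    (e : n.-tuple 'rV[R]_n) (he : orthonormal_basis e)
    (r : nat) (p : 'I_r -> 'rV[R]_n) (hp : forall i, enorm (p i) = 1)
    (k m : nat) (hm : (m <= n - 2)%N) :
  let hmn : (m <= n)%N := leq_trans hm (leq_subr 2 n) in
  posemidef (\matrix_(i < r, j < r)
    mgegenbauer n k (inner (p i) (p j))
      (first_coords hmn e (p i)) (first_coords hmn e (p j))).
Proof.
move=> hmn.
have Nge2 : (2 <= n - m)%N by lia.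
pose tail (x : 'rV[R]_n) : 'rV[R]_(n - m) :=
  \row_l coord e (cast_ord (subnKC hmn) (rshift m l)) x.
have split_inner x y : inner x y =
    inner (first_coords hmn e x) (first_coords hmn e y) + inner (tail x) (tail y).
  rewrite (inner_coord he) (reindex (cast_ord (subnKC hmn))) /=; last first.
    by apply/onW_bij; exists (cast_ord (esym (subnKC hmn)));
      [exact: cast_ordK | exact: cast_ordKV].
  rewrite big_split_ord /=; congr (_ + _); apply: eq_bigr => l _; rewrite !mxE //.
  by congr (coord e _ _ * coord e _ _); apply: val_inj.
have entryE i j : mgegenbauer n k (inner (p i) (p j))
    (first_coords hmn e (p i)) (first_coords hmn e (p j))
    = (zonal (tail (p j)) k).@[tail (p i) 0].
  have unit l : 1 - enorm (first_coords hmn e (p l)) ^+ 2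
      = inner (tail (p l)) (tail (p l)).
    by rewrite -(expr1n R 2) -(hp l) !enorm_sqr split_inner addrAC subrr add0r.
  rewrite meval_zonal /mgegenbauer !unit split_inner.
  by rewrite [inner (first_coords _ _ _) _ + _]addrC addrK.
split.
  apply/matrixP => i j; rewrite !mxE !entryE !meval_zonal innerC.
  by rewrite [X in hgegenbauer _ _ _ X]mulrC.
move=> c; have := zonal_posdef Nge2 k (tail \o p) (fun i => c i 0).
congr (0 <= _); rewrite mxE exchange_big; apply: eq_bigr => j _.
rewrite mxE mulr_suml; apply: eq_bigr => i _.
by rewrite !mxE entryE /=; ring.
Qed.
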